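(* Let $S$ be a finite-dimensional quantum system with Hilbert space $\mathcal H_S$ and Hamiltonian $H_S$, and let $\rho$ and $\rho'$ be density operators on $\mathcal H_S$. If there is no translationally invariant operation (TIO) on $S$ mapping $\rho$ to $\rho'$, then for every finite-dimensional auxiliary system $C$ with Hilbert space $\mathcal H_C$ and Hamiltonian $H_C$, and every pure state (unit vector) $|\phi\rangle\in\mathcal H_C$, there is no TIO $\mathcal E$ on the composite system $SC$ (with total Hamiltonian $H_S\otimes \mathbb 1+\mathbb 1\otimes H_C$) such that $\mathcal E(\rho\otimes|\phi\rangle\langle\phi|)=\rho'\otimes|\phi\rangle\langle\phi|$.
   Context: A Hamiltonian is a self-adjoint operator on the system's Hilbert space. For a quantum system with Hamiltonian $H$, a translationally invariant operation (TIO, or covariant operation) is a completely positive trace-preserving linear map $\mathcal E$ on the operators of that system satisfying $\mathcal E(e^{-iHt}\rho e^{iHt})=e^{-iHt}\mathcal E(\rho)e^{iHt}$ for all states $\rho$ and all $t\in\mathbb R$. The total Hamiltonian of a composite system $SC$ is $H_S\otimes\mathbb 1+\mathbb 1\otimes H_C$. *)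

(* Defs.v *)
From HB Require Import structures.
From mathcomp Require Import all_boot all_order all_algebra sesquilinear spectral.
From mathcomp Require Import complex.
From mathcomp Require mxtens.
From mathcomp Require Import all_classical all_reals all_analysis.

Set Implicit Arguments.
Unset Strict Implicit.
Unset Printing Implicit Defensive.

Import Order.TTheory GRing.Theory Num.Theory.
Import numFieldNormedType.Exports.

Local Open Scope ring_scope.
Local Open Scope complex_scope.
Local Open Scope sesquilinear_scope.

Notation "A *t B" := (mxtens.tensmx A B)
  (at level 40, left associativity, format "A  *t  B") : ring_scope.

(* Finite-dimensional systems are represented in an orthonormal basis: the
   Hilbert space is C^n (column vectors), operators are n x n matrices, and the
   basis of a composite system is indexed by 'I_(n * m) through
   mxtens.mxtens_index.  K is abstract in expmx because the library's topology
   on a numFieldType is attached to its structure; at K := R[i] it is the usual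
   topology of the complex plane. *)

Definition expmx (K : numFieldType) (n : nat) (A : 'M[K]_n) : 'M[K]_n :=
  limn (series (fun k => (k`!%:R)^-1 *: A ^+ k)).

Section Quantum.
Context {R : realType}.
Local Notation C := R[i].

Definition evol n (H : 'M[C]_n) (t : R) : 'M[C]_n :=
  expmx (- ('i * t%:C) *: H).

Definition psdmx n (A : 'M[C]_n) : Prop :=
  A \is hermsymmx /\ forall v : 'cV[C]_n, 0 <= (v^t* *m A *m v) 0 0.

Definition density n (rho : 'M[C]_n) : Prop := psdmx rho /\ \tr rho = 1.

Definition unit_vector n (phi : 'cV[C]_n) : Prop := (phi^t* *m phi) 0 0 = 1.

Definition ketbra n (phi : 'cV[C]_n) : 'M[C]_n := phi *m phi^t*.

Definition tens_block k n (X : 'M[C]_(k * n)) (a b : 'I_k) : 'M[C]_n :=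
  \matrix_(i, j) X (mxtens.mxtens_index (a, i)) (mxtens.mxtens_index (b, j)).

(* id_k (x) E, via X = \sum_(a, b) |a><b| (x) tens_block X a b. *)
Definition ampliation k n (E : {linear 'M[C]_n -> 'M[C]_n})
    (X : 'M[C]_(k * n)) : 'M[C]_(k * n) :=
  \sum_a \sum_b delta_mx a b *t E (tens_block X a b).

Definition completely_positive n (E : {linear 'M[C]_n -> 'M[C]_n}) : Prop :=
  forall (k : nat) (X : 'M[C]_(k * n)), psdmx X -> psdmx (ampliation E X).

Definition trace_preserving n (E : {linear 'M[C]_n -> 'M[C]_n}) : Prop :=
  forall X : 'M[C]_n, \tr (E X) = \tr X.

(* For Hermitian H, evol H (- t) = e^{iHt} is the inverse of evol H t. *)
Definition covariant n (H : 'M[C]_n) (E : {linear 'M[C]_n -> 'M[C]_n}) : Prop :=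
  forall (rho : 'M[C]_n) (t : R), density rho ->
    E (evol H t *m rho *m evol H (- t))
    = evol H t *m E rho *m evol H (- t).

Definition TIO n (H : 'M[C]_n) (E : {linear 'M[C]_n -> 'M[C]_n}) : Prop :=
  [/\ completely_positive E, trace_preserving E & covariant H E].

Definition total_hamiltonian n m (HS : 'M[C]_n) (HC : 'M[C]_m) : 'M[C]_(n * m) :=
  HS *t 1%:M + 1%:M *t HC.

Lemma tens_block_tens k n (A : 'M[C]_k) (B : 'M[C]_n) a b :
  tens_block (A *t B) a b = A a b *: B.
Proof. by apply/matrixP => i j; rewrite !mxE !mxtens.mxtens_indexK. Qed.

Lemma ampliation_tens k n (E : {linear 'M[C]_n -> 'M[C]_n})
    (A : 'M[C]_k) (B : 'M[C]_n) : ampliation E (A *t B) = A *t E B.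
Proof.
rewrite /ampliation {2}[A]matrix_sum_delta; apply/matrixP => i j.
rewrite !summxE mxE summxE mulr_suml; apply: eq_bigr => a _.
rewrite !summxE mulr_suml; apply: eq_bigr => b _.
by rewrite tens_block_tens linearZ !mxE mulrA [_ * A a b]mulrC.
Qed.

End Quantum.

(* Main.v *)
Require Import Defs.
From HB Require Import structures.
From mathcomp Require Import all_boot all_order all_algebra sesquilinear spectral.
From mathcomp Require Import complex all_classical all_reals all_analysis.
From mathcomp Require mxtens.
From mathcomp Require Import ring.

(* Write the given operation on SC with Kraus operators K_k of definite frequency,
   H K_k = K_k (H + w_k), and let rho = v v^*.  As the output on C is pure,
   K_k (v (x) phi) = l_k (x) phi with rho' = \sum_k l_k l_k^*.  Trace preservation
   then equates, for every r, the r-th moment of v (x) phi for H = HS (x) 1 + 1 (x) HC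
   with the sum over k of the r-th moments of l_k (x) phi for H - w_k.  Both sides are
   binomial convolutions with the moments <phi|HC^j|phi>, whose zeroth term is 1, so
   the catalyst cancels:
     v^* HS^r v = \sum_k l_k^* (HS - w_k)^r l_k  for all r.
   These Gram identities say that HS^r v |-> ((HS - w_k)^r l_k)_k is a well-defined
   covariant isometry on the Krylov space of v.  Its components L_k, together with
   1 - P for P the projection onto that space, are the Kraus operators of a TIO on S
   mapping rho to rho'. *)

Set Implicit Arguments.
Unset Strict Implicit.
Unset Printing Implicit Defensive.

Import Order.TTheory GRing.Theory Num.Theory.
Import numFieldNormedType.Exports.

Local Open Scope ring_scope.
Local Open Scope classical_set_scope.
Local Open Scope complex_scope.
Local Open Scope sesquilinear_scope.

(** * Matrix limits and the exponential of a diagonalised matrix *)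

Lemma cvg_mx_entry (K : numFieldType) (m n : nat) (A : nat -> 'M[K]_(m, n))
    (L : 'M[K]_(m, n)) :
  (forall i j, (fun k => A k i j) @ \oo --> L i j) -> A @ \oo --> L.
Proof.
move=> AL; apply/cvg_ballP => e e0.
have E (i : 'I_m) (j : 'I_n) : \forall k \near \oo, ball (L i j) e (A k i j).
  by move/cvg_ballP : (AL i j); exact.
near=> k; split=> //; near: k.
by apply: filter_forall => i; apply: filter_forall => j; exact: E.
Unshelve. all: by end_near. Qed.

Lemma cvgBMl (K : numFieldType) (c : K) (u v : nat -> K) (a b : K) :
  u @ \oo --> a -> v @ \oo --> b -> (fun k => u k - c * v k) @ \oo --> a - c * b.
Proof. by move=> ua vb; apply: (cvgB ua); exact: cvgMl_tmp. Qed.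

(** Powers of [Q d P] telescope because [P Q = 1], so each entry of a partial sum is a finite
    combination of scalar partial sums. *)
Lemma expmx_diag (K : numFieldType) (n : nat) (P Q : 'M[K]_n) (d l : 'rV[K]_n) :
  P *m Q = 1%:M ->
  (forall i, series (fun k => (k`!%:R)^-1 * d 0 i ^+ k) @ \oo --> l 0 i) ->
  expmx (Q *m diag_mx d *m P) = Q *m diag_mx l *m P.
Proof.
move=> PQ dl.
have QdPk k : (Q *m diag_mx d *m P) ^+ k = Q *m diag_mx (\row_i d 0 i ^+ k) *m P.
  elim: k => [|k IH].
    rewrite expr0 (_ : diag_mx _ = 1%:M); first by rewrite mulmx1 (mulmx1C PQ).
    by apply/matrixP => i j; rewrite !mxE expr0.
  rewrite exprS IH -!mulmxE !mulmxA -[_ *m P *m Q]mulmxA PQ mulmx1 -[_ *m diag_mx d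
    *m diag_mx _]mulmxA.
  congr (_ *m _ *m _); rewrite mul_diag_mx; apply/matrixP => i j.
  by rewrite !mxE exprS mulrnAr.
apply: norm_cvg_lim.
apply: cvg_mx_entry => i j.
rewrite (_ : (fun k => _) = (fun k => \sum_p Q i p * series (fun k => (k`!%:R)^-1 * d
  0 p ^+ k) k * P p j)).
  rewrite (_ : (Q *m _ *m P) i j = \sum_p Q i p * l 0 p * P p j).
    apply: cvg_big => [|p _]; first exact: add_continuous.
    by apply: cvgMr_tmp; exact: cvgMl_tmp.
  by rewrite mxE; apply: eq_bigr => p _; rewrite mul_mx_diag mxE.
apply/funext => k; rewrite /series /= summxE.
under [LHS]eq_bigr do rewrite mxE QdPk mxE mulr_sumr.
rewrite exchange_big /=; apply: eq_bigr => p _.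
rewrite mulr_sumr mulr_suml; apply: eq_bigr => q _.
by rewrite mul_mx_diag !mxE; ring.
Qed.

(** * The phase exp(-ix) and time evolution in an eigenbasis *)

Section expi.
Context {R : realType}.
Local Notation C := R[i].
(* The limit lemmas need the topology that R[i] carries as a numFieldType. *)
Local Notation CF := (R[i] : numFieldType).

(* exp(- i x) *)
Definition expmi (x : R) : C := (cos x)%:C - 'i * (sin x)%:C.

Lemma cvg_real_complex (u v : nat -> R) (a b : R) :
  u @ \oo --> a -> v @ \oo --> b ->
  (fun k => (u k)%:C - 'i * (v k)%:C : CF) @ \oo --> (a%:C - 'i * b%:C : CF).
Proof.
have toC (w : nat -> R) (c : R) : w @ \oo --> c ->
    (fun k => (w k)%:C : CF) @ \oo --> (c%:C : CF).
  move=> wc; apply/cvg_ballP => e e0.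
  (* A ball radius is a positive element of C, hence real, and the embedding of the reals is
     isometric. *)
  have [e' ee] : exists e' : R, e = e'%:C.
    by apply/complex_realP; exact: gtr0_real.
  move: e0; rewrite ee (ltcR 0) => e0.
  move/cvg_ballP : wc => /(_ e' e0); apply: filterS => k.
  rewrite -!ball_normE /= -raddfB /= normc_def /= expr0n /= addr0 sqrtr_sqr ltcR.
  by [].
move=> /toC ua /toC vb.
exact: (@cvgBMl CF 'i _ _ _ _ ua vb).
Qed.

(** Writing (-i)^k as (-i)^(odd k) times (-1)^(k/2) separates the cosine terms from the sine
    terms. *)
Lemma exp_coeff_expmi (x : R) (k : nat) :
  (k`!%:R)^-1 * (- ('i * x%:C)) ^+ k = (cos_coeff x k)%:C - 'i * (sin_coeff x k)%:C
    :> C.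
Proof.
have Ek : k = (odd k + k./2.*2)%N by rewrite odd_double_half.
have -> : (- ('i * x%:C)) ^+ k = ((- 'i) ^+ odd k * (-1) ^+ k./2) * (x ^+ k)%:C :> C.
  rewrite -mulNr exprMn rmorphXn /= {1}Ek exprD -muln2 mulnC exprM.
  by rewrite sqrrN sqr_i.
have -> : (k`!%:R)^-1 = ((k`!%:R)^-1 : R)%:C :> C.
  by rewrite fmorphV rmorph_nat.
rewrite /cos_coeff /sin_coeff /= !rmorphM /= !fmorphV !rmorph_nat.
have sgnC j : ((-1) ^+ j)%:C = (-1) ^+ j :> C by rewrite rmorphXn rmorphN rmorph1.
rewrite -exprnP !sgnC.
case: (boolP (odd k)) => ok /=; last by ring.
(* For odd k, the exponent (k-1)/2 of the sine coefficient is the truncated half of k. *)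
rewrite (_ : k.-1./2 = k./2); first by ring.
by case: k ok {Ek} => //= k; rewrite uphalf_half => /negbTE->.
Qed.

Lemma evol_spectral (n : nat) (P : 'M[C]_n) (h : 'I_n -> R) (t : R) :
  P \is unitarymx ->
  evol (P^t* *m diag_mx (\row_i (h i)%:C) *m P) t =
  P^t* *m diag_mx (\row_i expmi (h i * t)) *m P.
Proof.
move=> /unitarymxP PP; rewrite /evol scalemxAl scalemxAr -linearZ /=.
apply: expmx_diag => // i.
rewrite !mxE -mulNr mulrAC.
rewrite (_ : series _ = (fun k => (series (cos_coeff (h i * t)) k)%:C
   - 'i * (series (sin_coeff (h i * t)) k)%:C : CF)); last first.
  apply/funext => k; rewrite /series /= !raddf_sum mulr_sumr -sumrB.
  apply: eq_bigr => j _.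
  rewrite -exp_coeff_expmi rmorphM /=.
  by congr (_ * _ ^+ _); ring.
rewrite /expmi cos.unlock sin.unlock.
apply: cvg_real_complex; [exact: is_cvg_series_cos_coeff|].
exact: is_cvg_series_sin_coeff.
Qed.

Lemma expmi0 : expmi 0 = 1.
Proof. by rewrite /expmi cos0 sin0 mulr0 subr0. Qed.

Lemma expmiD x y : expmi (x + y) = expmi x * expmi y.
Proof.
rewrite /expmi cosD sinD rmorphB rmorphD !rmorphM /=.
rewrite [RHS](_ : _ = (cos x)%:C * (cos y)%:C + 'i ^+ 2 * ((sin x)%:C * (sin y)%:C)
  - 'i * ((sin x)%:C * (cos y)%:C + (cos x)%:C * (sin y)%:C)); last by ring.
by rewrite sqr_i mulN1r.
Qed.

Lemma expmi_neq0 x : expmi x != 0.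
Proof.
apply/negP => /eqP x0; have := expmiD x (- x).
by rewrite x0 mul0r subrr expmi0 => /eqP; rewrite oner_eq0.
Qed.

Lemma expmi_eq (a b : R) : (forall t, expmi (a * t) = expmi (b * t)) -> a = b.
Proof.
move=> ab; apply/eqP; rewrite -subr_eq0; apply/negPn/negP => ne.
(* At this time the two angles differ by pi, so the phases are opposite; being equal as well, they
   would vanish. *)
have := ab (pi / (a - b)).
have {1}-> : a * (pi / (a - b)) = pi + b * (pi / (a - b)) by field.
rewrite expmiD {1}/expmi cospi sinpi mulr0 subr0 rmorphN1 => /eqP.
rewrite mulN1r eq_sym -subr_eq0 opprK -mulr2n mulrn_eq0 /=.
by rewrite (negbTE (expmi_neq0 _)).
Qed.
End expi.

(** * Adjoints and Gram matrices *)

Section adjoint.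
Variable C : numClosedFieldType.

Lemma adjmxE m n (A : 'M[C]_(m, n)) i j : (A^t*) i j = Num.conj (A j i).
Proof. by rewrite !mxE. Qed.

Lemma adjmxM m n p (A : 'M[C]_(m, n)) (B : 'M[C]_(n, p)) :
  (A *m B)^t* = B^t* *m A^t*.
Proof. by rewrite trmx_mul map_mxM. Qed.

Lemma adjmxD m n (A B : 'M[C]_(m, n)) : (A + B)^t* = A^t* + B^t*.
Proof. by rewrite linearD /= map_mxD. Qed.

Lemma adjmxB m n (A B : 'M[C]_(m, n)) : (A - B)^t* = A^t* - B^t*.
Proof. by rewrite linearB /= map_mxB. Qed.

Lemma adjmxZ m n c (A : 'M[C]_(m, n)) : (c *: A)^t* = c^* *: A^t*.
Proof. by rewrite linearZ /= map_mxZ. Qed.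

Lemma adjmx1 n : (1%:M : 'M[C]_n)^t* = 1%:M.
Proof. by rewrite trmx1 map_mx1. Qed.

Lemma adjmx0 m n : (0 : 'M[C]_(m, n))^t* = 0.
Proof. by rewrite trmx0 map_mx0. Qed.

Lemma adjmx_sum m n (I : Type) (r : seq I) (P : pred I) (F : I -> 'M[C]_(m, n)) :
  (\sum_(i <- r | P i) F i)^t* = \sum_(i <- r | P i) (F i)^t*.
Proof. by apply: (big_morph (fun A => A^t*)); [exact: adjmxD|exact: adjmx0]. Qed.

Lemma adjmx_exp n (A : 'M[C]_n) k : (A ^+ k)^t* = (A^t*) ^+ k.
Proof.
elim: k => [|k IH]; first by rewrite !expr0 adjmx1.
by rewrite exprS exprSr -!mulmxE adjmxM IH.
Qed.

Lemma hermsymmxP n {A : 'M[C]_n} : reflect (A^t* = A) (A \is hermsymmx).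
Proof.
by apply: (iffP (is_hermitianmxP _ _ _)); rewrite expr0 scale1r => /esym.
Qed.

Lemma dot_adjmx_ge0 m n (A : 'M[C]_(m, n)) i : 0 <= (A^t* *m A) i i.
Proof.
by rewrite mxE sumr_ge0 // => k _; rewrite !mxE mulrC mul_conjC_ge0.
Qed.

Lemma dot_adjmx_eq0 m n (A : 'M[C]_(m, n)) i j : (A^t* *m A) j j = 0 -> A i j = 0.
Proof.
rewrite mxE => /eqP; rewrite psumr_eq0 => [|k _];
  last by rewrite !mxE mulrC mul_conjC_ge0.
by move=> /allP/(_ i); rewrite mem_index_enum !mxE mulrC mul_conjC_eq0 => /(_ isT)/eqP.
Qed.

(** Diagonal entries of the sum are sums of squared moduli. One summed identity thus makes a whole
    family vanish. *)
Lemma sum_adjmx_mul_eq0 (I : finType) m n (A : I -> 'M[C]_(m, n)) :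
  \sum_i (A i)^t* *m A i = 0 -> forall i, A i = 0.
Proof.
move=> A0 i; apply/matrixP => p q; rewrite mxE; apply: dot_adjmx_eq0.
have := congr1 (fun M : 'M[C]_n => M q q) A0; rewrite summxE mxE => /eqP.
rewrite psumr_eq0 => [/allP/(_ i)|k _]; last exact: dot_adjmx_ge0.
by rewrite mem_index_enum => /(_ isT)/eqP.
Qed.

End adjoint.

(** * Spectral theorem, positive square roots and pseudo-inverses *)

Section spectral.
Context {R : realType}.
Local Notation C := R[i].

Lemma herm_spectral n (H : 'M[C]_n) : H \is hermsymmx ->
  exists P : 'M[C]_n, exists h : 'I_n -> R,
    P \is unitarymx /\ H = P^t* *m diag_mx (\row_i (h i)%:C) *m P.
Proof.
move=> Hh; exists (spectralmx H), (fun i => complex.Re (spectral_diag H 0 i)).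
split; first exact: spectral_unitarymx.
have /orthomx_spectralP := hermitian_normalmx Hh.
rewrite invmx_unitary ?spectral_unitarymx // => {1}->.
congr (_ *m diag_mx _ *m _); apply/rowP => i; rewrite !mxE RRe_real //.
by have /mxOverP := hermitian_spectral_diag_real Hh; exact.
Qed.

Lemma psdmx_adj n (A : 'M[C]_n) : psdmx A -> A^t* = A.
Proof. by case=> /hermsymmxP. Qed.

Lemma psdmx_conj n m (A : 'M[C]_(m, n)) (X : 'M[C]_n) :
  psdmx X -> psdmx (A *m X *m A^t*).
Proof.
move=> Xp; split=> [|v].
  by apply/hermsymmxP; rewrite !adjmxM trmxCK (psdmx_adj Xp) mulmxA.
have := Xp.2 (A^t* *m v); by rewrite adjmxM trmxCK !mulmxA.
Qed.

Lemma psdmx1 n : psdmx (1%:M : 'M[C]_n).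
Proof.
split=> [|v]; first by apply/hermsymmxP; rewrite adjmx1.
by rewrite mulmx1 dot_adjmx_ge0.
Qed.

Lemma psdmx_sum n (I : Type) (r : seq I) (F : I -> 'M[C]_n) :
  (forall i, psdmx (F i)) -> psdmx (\sum_(i <- r) F i).
Proof.
move=> Fp; split=> [|v].
  by apply/hermsymmxP; rewrite adjmx_sum; apply: eq_bigr => i _; exact: psdmx_adj.
rewrite mulmx_sumr mulmx_suml summxE sumr_ge0 // => i _; exact: (Fp i).2.
Qed.

Lemma psdmx_sqrt n (A : 'M[C]_n) : psdmx A ->
  exists S : 'M[C]_n, [/\ S^t* = S, S *m S = A &
    forall X, A *m X = X *m A -> S *m X = X *m S].
Proof.
move=> Ap; have [P [h [/unitarymxP PP AE]]] := herm_spectral Ap.1.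
have P'P := mulmx1C PP.
(* The test vector is the eigenvector of [A] for [h i]. *)
have h0 i : 0 <= h i.
  have := Ap.2 (P^t* *m delta_mx i 0).
  rewrite AE adjmxM trmxCK !mulmxA -[_ *m P *m P^t*]mulmxA PP mulmx1.
  rewrite -[_ *m P *m P^t*]mulmxA PP mulmx1 -mulmxA mul_diag_mx mxE (bigD1 i) //=
    big1 ?addr0.
    by rewrite !mxE !eqxx /= rmorph1 mul1r mulr1 ler0c.
  by move=> j ji; rewrite !mxE (negbTE ji) rmorph0 mul0r.
pose s := \row_i (Num.sqrt (h i))%:C : 'rV[C]_n.
exists (P^t* *m diag_mx s *m P); split.
- rewrite !adjmxM trmxCK mulmxA tr_diag_mx map_diag_mx; congr (_ *m diag_mx _ *m _).
  by apply/rowP => i; rewrite !mxE; exact: conjc_real.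
- rewrite AE !mulmxA -[_ *m P *m P^t*]mulmxA PP mulmx1 -[_ *m _ *m diag_mx _]mulmxA.
  congr (_ *m _ *m _); rewrite mul_diag_mx; apply/matrixP => i j; rewrite !mxE.
  by rewrite mulrnAr -rmorphM -expr2 sqr_sqrtr.
move=> X AX.
have {}AX : diag_mx (\row_i (h i)%:C) *m (P *m X *m P^t*) =
            (P *m X *m P^t*) *m diag_mx (\row_i (h i)%:C).
  move: (congr1 (fun M => P *m M *m P^t*) AX); rewrite AE !mulmxA PP mul1mx.
  by rewrite -!mulmxA PP mulmx1.
(* In the eigenbasis, commuting means (h_i - h_j) Y_ij = 0: an entry vanishes or joins equal
   eigenvalues, whose roots agree. *)
have {AX} sX : diag_mx s *m (P *m X *m P^t*) = (P *m X *m P^t*) *m diag_mx s.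
  move: (P *m X *m P^t*) AX => Y /matrixP AX; apply/matrixP => i j; move: (AX i j).
  rewrite !mul_diag_mx !mul_mx_diag !mxE.
  rewrite [in RHS]mulrC => /eqP; rewrite -subr_eq0 -mulrBl mulf_eq0 => /orP[|/eqP Y0].
    by rewrite subr_eq0 => /eqP/complexI ->; rewrite mulrC.
  by rewrite Y0 mulr0 mul0r.
move: (congr1 (fun M => P^t* *m M *m P) sX); rewrite !mulmxA P'P mul1mx => <-.
by rewrite -!mulmxA P'P mulmx1.
Qed.

(* Inverting eigenvalues gives the Moore-Penrose inverse because 0^-1 = 0. *)
Lemma herm_pinv n (A : 'M[C]_n) : A^t* = A ->
  exists B : 'M[C]_n, [/\ B^t* = B, A *m B *m A = A & B *m A = A *m B].
Proof.
move=> /hermsymmxP /herm_spectral[P [h [/unitarymxP PP AE]]].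
pose s := \row_i (h i)^-1%:C : 'rV[C]_n.
exists (P^t* *m diag_mx s *m P); split.
- rewrite !adjmxM trmxCK mulmxA tr_diag_mx map_diag_mx; congr (_ *m diag_mx _ *m _).
  by apply/rowP => i; rewrite !mxE; exact: conjc_real.
- rewrite AE !mulmxA -[_ *m P *m P^t*]mulmxA PP mulmx1 -[_ *m P *m P^t*]mulmxA PP
  mulmx1.
  rewrite -!mulmxA; congr (_ *m _); rewrite !mulmxA; congr (_ *m _).
  apply/matrixP => i j; rewrite mul_mx_diag mxE mul_mx_diag !mxE.
  have [->|h0] := eqVneq (h i) 0; case: eqP => [<-|];
    rewrite ?mulr0n ?mul0r // !mulr1n -!rmorphM ?mul0r ?divff ?mul1r //.
rewrite AE !mulmxA -[_ *m P *m P^t*]mulmxA PP mulmx1 -[_ *m P *m P^t*]mulmxA PP mulmx1.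
by rewrite -![_ *m _ *m diag_mx _]mulmxA diag_mxC.
Qed.

End spectral.

(** * Covariance in infinitesimal form *)

Section covariance.
Context {R : realType}.
Local Notation C := R[i].

(** Normalised rank-one operators are density operators, and polarisation recovers every matrix unit
    from them. Covariance on states therefore extends to all operators. *)
Lemma eq_density_linear n p (F G : {linear 'M[C]_n -> 'M[C]_p}) :
  (forall rho, density rho -> F rho = G rho) -> F =1 G.
Proof.
move=> FG.
have ket (x : 'cV[C]_n) : F (x *m x^t*) = G (x *m x^t*).
  have [->|x0] := eqVneq x 0; first by rewrite mul0mx !linear0.
  pose c := (x^t* *m x) 0 0.
  have c0 : c != 0.
    apply: contra x0 => /eqP c0; apply/eqP/matrixP => i j.
    by rewrite mxE (dot_adjmx_eq0 _ (j := j)) // ord1.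
  have cE : x *m x^t* = c *: (c^-1 *: (x *m x^t*)) by rewrite scalerA divff // scale1r.
  rewrite cE [LHS]linearZ [RHS]linearZ; congr (_ *: _); apply: FG; split; last first.
    by rewrite linearZ /= mxtrace_mulC /mxtrace big_ord1 mulVf.
  have cR : Num.conj c^-1 = c^-1.
    by apply/CrealP/ger0_real; rewrite invr_ge0 dot_adjmx_ge0.
  have xx : psdmx (x *m x^t*) by rewrite -[x]mulmx1; have := psdmx_conj x (psdmx1 1);
    rewrite !mulmx1.
  split; first by apply/hermsymmxP; rewrite adjmxZ cR (psdmx_adj xx).
  by move=> v; rewrite -scalemxAr -scalemxAl mxE mulr_ge0 ?(xx.2 v) // invr_ge0
    dot_adjmx_ge0.
pose D X := F X - G X.
have DD : {morph D : X Y / X + Y} by move=> X Y;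
  rewrite /D (linearD F) (linearD G) opprD addrACA.
have DZ a X : D (a *: X) = a *: D X by rewrite /D [F _]linearZ [G _]linearZ /= scalerBr.
have Dket (x : 'cV[C]_n) : D (x *m x^t*) = 0 by rewrite /D ket subrr.
have polar (u : C) (x y : 'cV[C]_n) :
    Num.conj u *: D (x *m y^t*) + u *: D (y *m x^t*) = 0.
  have := Dket (x + u *: y).
  rewrite adjmxD adjmxZ mulmxDl !mulmxDr -!scalemxAl -!scalemxAr !DD !DZ !Dket.
  by rewrite !scaler0 addr0 add0r.
have D0 (x y : 'cV[C]_n) : D (x *m y^t*) = 0.
  have := polar 1 x y; rewrite conjC1 !scale1r => /eqP; rewrite addr_eq0 => /eqP xy.
  (* The case u = 1 made the two values of [D] opposite; for u = i, 2i times one of them remains. *)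
  have := polar 'i%C x y; rewrite xy scalerN -scaleNr -scalerDl => /eqP.
  rewrite scaler_eq0 => /orP[|/eqP ->]; last by rewrite oppr0.
  by rewrite eq_complex /= !oppr0 opprK addr0 eqxx -mulr2n mulrn_eq0 oner_eq0.
have D00 : D 0 = 0 by rewrite -(scale0r 0) DZ scale0r.
move=> X; apply/eqP; rewrite -subr_eq0 -[_ - _]/(D X) (matrix_sum_delta X).
rewrite (big_morph D DD D00) big1 // => i _;
  rewrite (big_morph D DD D00) big1 // => j _.
rewrite DZ (_ : delta_mx i j = delta_mx i 0 *m (delta_mx j 0 : 'cV[C]_n)^t*).
  by rewrite D0 scaler0.
by rewrite trmx_delta map_delta_mx mul_delta_mx.
Qed.

(* In an eigenbasis of H, both sides say that E maps each matrix unit |i><j| to an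
   operator supported on the entries (p, q) with h_p - h_q = h_i - h_j. *)
Lemma covariantP n (H : 'M[C]_n) (E : {linear 'M[C]_n -> 'M[C]_n}) :
  H \is hermsymmx ->
  covariant H E <-> forall X, E (H *m X - X *m H) = H *m E X - E X *m H.
Proof.
move=> /herm_spectral[P [h [PU HE]]]; have PP := unitarymxP PU; have P'P := mulmx1C PP.
pose U t := evol H t.
have UE t : U t = P^t* *m diag_mx (\row_i expmi (h i * t)) *m P.
  by rewrite /U HE evol_spectral.
(* Matrix units of the eigenbasis, on which both the commutator with [H] and conjugation by [U t]
   are diagonal. *)
pose e i j := P^t* *m delta_mx i j *m P.
have diag_e (d : 'rV[C]_n) i j : P^t* *m diag_mx d *m P *m e i j = d 0 i *: e i j.
  rewrite /e !mulmxA -[_ *m P *m P^t*]mulmxA PP mulmx1 -[_ *m diag_mx d *m _]mulmxA.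
  rewrite (_ : diag_mx d *m delta_mx i j =
    d 0 i *: delta_mx i j) -?scalemxAr -?scalemxAl //.
  by rewrite mul_diag_mx; apply/matrixP => k l; rewrite !mxE; case: eqP => [->|_]//=;
    rewrite !mulr0.
have e_diag (d : 'rV[C]_n) i j : e i j *m (P^t* *m diag_mx d *m P) = d 0 j *: e i j.
  rewrite /e !mulmxA -[_ *m P *m P^t*]mulmxA PP mulmx1 -[_ *m delta_mx i j *m _]mulmxA.
  rewrite (_ : delta_mx i j *m diag_mx d =
    d 0 j *: delta_mx i j) -?scalemxAr -?scalemxAl //.
  by rewrite mul_mx_diag; apply/matrixP => k l; rewrite !mxE;
    case: (l =P j) => [->|_]; rewrite ?andbF ?mul0r ?mulr0 // mulrC.
have e_span (F G : {linear 'M[C]_n -> 'M[C]_n}) : (forall i j, F (e i j) =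
  G (e i j)) -> F =1 G.
  move=> FG X; rewrite (_ : X = P^t* *m (P *m X *m P^t*) *m P); last first.
    by rewrite !mulmxA P'P mul1mx -mulmxA P'P mulmx1.
  rewrite [P *m X *m _]matrix_sum_delta !mulmx_sumr !mulmx_suml !linear_sum;
    apply: eq_bigr => i _.
  rewrite !mulmx_sumr !mulmx_suml !linear_sum; apply: eq_bigr => j _.
  by rewrite -scalemxAr -scalemxAl 2!linearZ /= FG.
pose y i j p q := (P *m E (e i j) *m P^t*) p q.
have entP (A B : 'M[C]_n) : (forall p q, (P *m A *m P^t*) p q =
  (P *m B *m P^t*) p q) <-> A = B.
  split=> [AB|->//]; have /(congr1 (fun M => P^t* *m M *m P)) : P *m A *m P^t* =
    P *m B *m P^t*.
    by apply/matrixP.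
  by rewrite !mulmxA P'P !mul1mx -!mulmxA P'P !mulmx1.
have conj_diag (d : 'rV[C]_n) A p q : (P *m (P^t* *m diag_mx d *m P *m A) *m P^t*) p
  q = d 0 p * (P *m A *m P^t*) p q.
  rewrite !mulmxA PP mul1mx -!mulmxA; by rewrite mul_diag_mx mxE.
have diag_conj (d : 'rV[C]_n) A p q : (P *m (A *m (P^t* *m diag_mx d *m P)) *m P^t*)
  p q = (P *m A *m P^t*) p q * d 0 q.
  rewrite !mulmxA -mulmxA PP mulmx1; by rewrite mul_mx_diag mxE.
(* Common form of both conditions: if [S] multiplies [e i j] by m(h_i - h_j), then [E] commutes with
   [S] exactly when it links only matrix units with equal multipliers. Used with m(x) = x and with
   m(x) = exp(-ixt). *)
have multP (S : {linear 'M[C]_n -> 'M[C]_n}) (m : R -> C) :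
    (forall i j, S (e i j) = m (h i - h j) *: e i j) ->
    (forall A p q, (P *m S A *m P^t*) p q = m (h p - h q) * (P *m A *m P^t*) p q) ->
    (forall X, E (S X) = S (E X)) <->
    (forall i j p q, m (h i - h j) * y i j p q = m (h p - h q) * y i j p q).
  move=> Se Sent; have yE i j p q : m (h i - h j) * y i j p q =
    (P *m E (S (e i j)) *m P^t*) p q.
    by rewrite Se linearZ -scalemxAr -scalemxAl [RHS]mxE.
  split=> [ES i j p q|mZ].
    by rewrite yE ES Sent.
  apply: (e_span (E \o S) (S \o E)) => i j; apply/entP => p q /=.
  by rewrite -yE mZ Sent.
have comm_m := multP (mulmx H \- mulmxr H) (real_complex R).
have conj_m t := multP (mulmxr (U (- t)) \o mulmx (U t)) (fun x => expmi (x * t)).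
have {}comm_m : (forall X, E (H *m X - X *m H) = H *m E X - E X *m H) <->
    (forall i j p q, (h i - h j)%:C * y i j p q = (h p - h q)%:C * y i j p q).
  apply: comm_m => [i j|A p q] /=.
    by rewrite HE diag_e e_diag !mxE -scalerBl -rmorphB.
  rewrite mulmxBr mulmxBl mxE [X in _ + X]mxE HE conj_diag diag_conj !mxE.
  by rewrite rmorphB mulrBl [X in _ - X]mulrC.
have {}conj_m t : (forall X, E (U t *m X *m U (- t)) = U t *m E X *m U (- t)) <->
    (forall i j p q, expmi ((h i - h j) * t) * y i j p q =
      expmi ((h p - h q) * t) * y i j p q).
  apply: conj_m => [i j|A p q] /=.
    by rewrite !UE diag_e -scalemxAl e_diag scalerA !mxE -expmiD mulrN mulrBl.
  by rewrite !UE diag_conj conj_diag mulrAC ![(\row__ _) _ _]mxE -expmiD mulrN -mulrBl.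
rewrite comm_m; split=> [cov i j p q|zz rho t _].
  have [->|y0] := eqVneq (y i j p q) 0; first by rewrite !mulr0.
  (* A nonzero entry forces equal phases at all times, hence equal frequencies. *)
  congr (_%:C * _); apply: expmi_eq => t; apply: (mulIf y0).
  apply: ((conj_m t).1 _ i j p q) => X.
  apply: (eq_density_linear (F := E \o (mulmxr (U (- t)) \o mulmx (U t)))
    (G := (mulmxr (U (- t)) \o mulmx (U t)) \o E)) => rho rhod /=.
  exact: cov.
apply: (conj_m t).2 => i j p q.
have [->|y0] := eqVneq (y i j p q) 0; first by rewrite !mulr0.
by have /(mulIf y0)/complexI -> := zz i j p q.
Qed.

End covariance.

(** * Tensor products, their blocks, and embeddings by a fixed vector *)

Section tensor.
Context {R : realType}.
Local Notation C := R[i].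
Local Notation idx := mxtens.mxtens_index.

Lemma big_mxtens_index (V : nmodType) m n (F : 'I_(m * n) -> V) :
  \sum_k F k = \sum_i \sum_j F (idx (i, j)).
Proof.
rewrite pair_big /= (reindex (@mxtens.mxtens_index m n)) /=.
  by apply: eq_bigr => -[].
exists (@mxtens.mxtens_unindex m n) => k _.
- exact: mxtens.mxtens_indexK.
- exact: mxtens.mxtens_unindexK.
Qed.

Lemma adjmx_tens m n p q (A : 'M[C]_(m, n)) (B : 'M[C]_(p, q)) :
  (A *t B)^t* = A^t* *t B^t*.
Proof. by rewrite mxtens.trmx_tens mxtens.map_mxT. Qed.

Lemma tens_mul_entry m n k l p (A : 'M[C]_(m, k)) (B : 'M[C]_(n, l)) (X : 'M[C]_(k *
  l, p)) i a q :
  (A *t B *m X) (idx (i, a)) q = \sum_c \sum_d A i c * B a d * X (idx (c, d)) q.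
Proof.
rewrite mxE big_mxtens_index; apply: eq_bigr => c _; apply: eq_bigr => d _.
by rewrite mxtens.tensmxE.
Qed.

Lemma mul_tens_entry m n k l p (A : 'M[C]_(k, m)) (B : 'M[C]_(l, n)) (X : 'M[C]_(p, k
  * l)) i a q :
  (X *m (A *t B)) q (idx (i, a)) = \sum_c \sum_d X q (idx (c, d)) * (A c i * B d a).
Proof.
rewrite mxE big_mxtens_index; apply: eq_bigr => c _; apply: eq_bigr => d _.
by rewrite mxtens.tensmxE.
Qed.

Lemma eq_mxtens_row m n p (X Y : 'M[C]_(m * n, p)) :
  (forall i a q, X (idx (i, a)) q = Y (idx (i, a)) q) -> X = Y.
Proof.
by move=> XY; apply/matrixP => k q; case: (mxtens.mxtens_indexP k) => i a; exact: XY.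
Qed.

(* The isometry x |-> x (x) psi. *)
Definition emb n m (psi : 'cV[C]_m) : 'M[C]_(n * m, n) :=
  \matrix_(k, j) (((mxtens.mxtens_unindex k).1 == j)%:R * psi (mxtens.mxtens_unindex
    k).2 0).

Lemma embE n m (psi : 'cV[C]_m) i a (j : 'I_n) :
  emb n psi (idx (i, a)) j = (i == j)%:R * psi a 0.
Proof. by rewrite mxE mxtens.mxtens_indexK. Qed.

Lemma tens_emb n m (A : 'M[C]_n) (B : 'M[C]_m) psi :
  (A *t B) *m emb n psi = emb n (B *m psi) *m A.
Proof.
apply: eq_mxtens_row => i a j; rewrite tens_mul_entry (bigD1 j) //= [X in _ + X]big1
  => [|c cj]; last first.
  by rewrite big1 // => d _; rewrite embE (negbTE cj) mul0r mulr0.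
rewrite addr0 [RHS]mxE (bigD1 i) //= [X in _ = _ + X]big1 => [|c ci]; last first.
  by rewrite embE [i == c]eq_sym (negbTE ci) !mul0r.
rewrite addr0 embE eqxx mul1r mxE mulr_suml; apply: eq_bigr => d _.
by rewrite embE eqxx mul1r -mulrA mulrC.
Qed.

Lemma adj_emb_emb n m (psi phi : 'cV[C]_m) :
  (emb n psi)^t* *m emb n phi = ((psi^t* *m phi) 0 0)%:M.
Proof.
apply/matrixP => i j; rewrite !mxE big_mxtens_index (bigD1 j) //= [X in _ + X]big1 =>
  [|c cj]; last first.
  by rewrite big1 // => d _; rewrite !embE (negbTE cj) mul0r mulr0.
rewrite addr0 -mulr_natr mulr_suml; apply: eq_bigr => a _.
rewrite mxE mxE !embE !mxE eqxx mul1r rmorphM /= eq_sym.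
by case: (i == j); rewrite ?rmorph1 ?rmorph0; ring.
Qed.

(** Presents the catalytic input and output as conjugates of rho and rho' by the isometry
    [emb n phi]. *)
Lemma emb_mul_adj n m (A : 'M[C]_n) (phi : 'cV[C]_m) :
  emb n phi *m A *m (emb n phi)^t* = A *t ketbra phi.
Proof.
apply: eq_mxtens_row => i a k; case: (mxtens.mxtens_indexP k) => j b.
rewrite mxtens.tensmxE mxE (bigD1 j) //= big1 => [|c cj]; last first.
  by rewrite adjmxE embE [_ == c]eq_sym (negbTE cj) mul0r rmorph0 mulr0.
rewrite addr0 mxE (bigD1 i) //= big1 => [|c ci]; last first.
  by rewrite embE [_ == c]eq_sym (negbTE ci) !mul0r.
rewrite addr0 adjmxE !embE !eqxx !mul1r [in RHS]mxE big_ord1 adjmxE.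
by rewrite mulrAC mulrC.
Qed.

Lemma tens_block_inj k n (X Y : 'M[C]_(k * n)) :
  (forall a b, tens_block X a b = tens_block Y a b) -> X = Y.
Proof.
move=> XY; apply: eq_mxtens_row => a i q; case: (mxtens.mxtens_indexP q) => b j.
by have /matrixP/(_ i j) := XY a b; rewrite !mxE.
Qed.

Lemma tens_block_sum k n (I : Type) (r : seq I) (F : I -> 'M[C]_(k * n)) a b :
  tens_block (\sum_(i <- r) F i) a b = \sum_(i <- r) tens_block (F i) a b.
Proof.
by apply/matrixP => i j; rewrite mxE !summxE; apply: eq_bigr => l _; rewrite mxE.
Qed.

Lemma tens_block_ampliation k n (E : {linear 'M[C]_n -> 'M[C]_n}) (X : 'M[C]_(k * n))
  a b :
  tens_block (ampliation E X) a b = E (tens_block X a b).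
Proof.
rewrite /ampliation tens_block_sum (bigD1 a) //= [X in _ + X]big1 => [|c ca].
  rewrite addr0 tens_block_sum (bigD1 b) //= [X in _ + X]big1 => [|d db].
    by rewrite tens_block_tens mxE !eqxx scale1r addr0.
  by rewrite tens_block_tens mxE [b == d]eq_sym (negbTE db) andbF scale0r.
rewrite tens_block_sum big1 // => d _.
by rewrite tens_block_tens mxE [a == c]eq_sym (negbTE ca) scale0r.
Qed.

Lemma tens_block_mull k n (A : 'M[C]_k) (B : 'M[C]_n) X a b :
  tens_block ((A *t B) *m X) a b = \sum_c A a c *: (B *m tens_block X c b).
Proof.
apply/matrixP => i j; rewrite mxE tens_mul_entry summxE; apply: eq_bigr => c _.
by rewrite !mxE mulr_sumr; apply: eq_bigr => d _; rewrite mxE mulrA.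
Qed.

Lemma tens_block_mulr k n (A : 'M[C]_k) (B : 'M[C]_n) X a b :
  tens_block (X *m (A *t B)) a b = \sum_c A c b *: (tens_block X a c *m B).
Proof.
apply/matrixP => i j; rewrite mxE mul_tens_entry summxE; apply: eq_bigr => c _.
by rewrite !mxE mulr_sumr; apply: eq_bigr => d _; rewrite mxE; ring.
Qed.

Lemma tens_block_mul1 k n (B : 'M[C]_n) (X : 'M[C]_(k * n)) a b :
  tens_block ((1%:M *t B) *m X) a b = B *m tens_block X a b.
Proof.
rewrite tens_block_mull (bigD1 a) //= big1 ?addr0 => [|c ca];
  first by rewrite mxE eqxx scale1r.
by rewrite mxE eq_sym (negbTE ca) scale0r.
Qed.

Lemma tens_block_mulr1 k n (B : 'M[C]_n) (X : 'M[C]_(k * n)) a b :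
  tens_block (X *m (1%:M *t B)) a b = tens_block X a b *m B.
Proof.
rewrite tens_block_mulr (bigD1 b) //= big1 ?addr0 => [|c ca];
  first by rewrite mxE eqxx scale1r.
by rewrite mxE (negbTE ca) scale0r.
Qed.

End tensor.

(** * Kraus operators of definite frequency *)

Section kraus.
Context {R : realType}.
Local Notation C := R[i].
Local Notation idx := mxtens.mxtens_index.

Definition kraus (I : finType) n (K : I -> 'M[C]_n) (X : 'M[C]_n) : 'M[C]_n :=
  \sum_i K i *m X *m (K i)^t*.

Lemma kraus_is_linear (I : finType) n (K : I -> 'M[C]_n) : linear (kraus K).
Proof.
move=> a X Y; rewrite /kraus scaler_sumr -big_split; apply: eq_bigr => i _ /=.
by rewrite mulmxDr mulmxDl -scalemxAr -scalemxAl.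
Qed.

HB.instance Definition _ (I : finType) n (K : I -> 'M[C]_n) :=
  GRing.isLinear.Build C 'M[C]_n 'M[C]_n *:%R (kraus K) (kraus_is_linear K).

(** The ampliation has Kraus operators [1%:M *t K i], hence complete positivity. For covariance, the
    shift [w i] from [K i] cancels the one from its adjoint. *)
Lemma kraus_TIO (I : finType) n (H : 'M[C]_n) (K : I -> 'M[C]_n) (w : I -> R) :
  H \is hermsymmx -> \sum_i (K i)^t* *m K i = 1%:M ->
  (forall i, H *m K i = K i *m H + (w i)%:C *: K i) -> TIO H (kraus K).
Proof.
move=> Hh K1 HK; split.
- move=> k X Xp.
  rewrite (_ : ampliation _ X = \sum_i (1%:M *t K i) *m X *m (1%:M *t K i)^t*).
    by apply: psdmx_sum => i; exact: psdmx_conj.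
  apply: tens_block_inj => a b; rewrite tens_block_ampliation tens_block_sum.
  apply: eq_bigr => i _.
  by rewrite adjmx_tens adjmx1 tens_block_mulr1 tens_block_mul1.
- move=> X; rewrite /= /kraus raddf_sum /=.
  under eq_bigr do rewrite mxtrace_mulC mulmxA.
  by rewrite -raddf_sum /= -mulmx_suml K1 mul1mx.
apply/(covariantP _ Hh) => X; rewrite /= /kraus mulmx_sumr mulmx_suml -sumrB.
apply: eq_bigr => i _.
have KH : (K i)^t* *m H = H *m (K i)^t* + (w i)%:C *: (K i)^t*.
  have := congr1 (fun A => A^t*) (HK i); rewrite !adjmxM (hermsymmxP Hh) => ->.
  rewrite adjmxD adjmxM (hermsymmxP Hh) adjmxZ; congr (_ + _ *: _); exact: conjc_real.
rewrite !mulmxA HK -[_ *m _ *m H]mulmxA KH.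
rewrite mulmxBr mulmxBl mulmxDr !mulmxDl -!scalemxAl -!scalemxAr !mulmxA.
by rewrite opprD addrACA subrr addr0.
Qed.

(* Covariance makes the Choi matrix J commute with T = 1 (x) H - H^T (x) 1.  The
   columns of sqrt J in an eigenbasis of T, read as matrices, are the K_k. *)
Lemma TIO_kraus n (H : 'M[C]_n) (E : {linear 'M[C]_n -> 'M[C]_n}) :
  H \is hermsymmx -> TIO H E ->
  exists K : 'I_(n * n) -> 'M[C]_n, exists w : 'I_(n * n) -> R,
    [/\ E =1 kraus K, \sum_i (K i)^t* *m K i = 1%:M &
        forall i, H *m K i = K i *m H + (w i)%:C *: K i].
Proof.
move=> Hh [Ecp Etp /(covariantP _ Hh) Ecov].
(* The unnormalised maximally entangled vector; the blocks of [J] are then the images of the matrix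
   units. *)
pose u : 'cV[C]_(n * n) := \col_k ((mxtens.mxtens_unindex k).1 ==
  (mxtens.mxtens_unindex k).2)%:R.
pose J := ampliation E (u *m u^t*).
have Jb a b : tens_block J a b = E (delta_mx a b).
  rewrite tens_block_ampliation; congr (E _); apply/matrixP => i j.
  rewrite !mxE big_ord1 !mxE !mxtens.mxtens_indexK /= -mulnb natrM [i == a]eq_sym [j
    == b]eq_sym.
  by case: (b == j); rewrite ?rmorph1 ?rmorph0.
have Jp : psdmx J.
  by apply: Ecp; rewrite -[u]mulmx1; have := psdmx_conj u (psdmx1 1); rewrite !mulmx1.
pose T : 'M[C]_(n * n) := 1%:M *t H - H^T *t 1%:M.
have Th : T \is hermsymmx.
  apply/hermsymmxP; rewrite adjmxB !adjmx_tens !adjmx1 (hermsymmxP Hh).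
  by rewrite -map_trmx (hermsymmxP Hh).
(* The factor [H^T] of [T] mixes the blocks of [J]; by linearity this is multiplication by [H]
   inside [E]. *)
have HdE a b : \sum_c H c a *: E (delta_mx c b) = E (H *m delta_mx a b).
  rewrite (_ : H *m _ = \sum_c H c a *: delta_mx c b); first by rewrite linear_sum;
    apply: eq_bigr => c _; rewrite linearZ.
  apply/matrixP => i j; rewrite mxE summxE (bigD1 a) //= [X in _ + X =
    _]big1 => [|c ca]; last first.
    by rewrite mxE (negbTE ca) mulr0.
  rewrite addr0 [RHS](bigD1 i) //= [X in _ = _ + X]big1 => [|c ci]; last first.
    by rewrite !mxE eq_sym (negbTE ci) mulr0.
  by rewrite !mxE !eqxx addr0.
have dHE a b : \sum_c H b c *: E (delta_mx a c) = E (delta_mx a b *m H).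
  rewrite (_ : _ *m H = \sum_c H b c *: delta_mx a c); first by rewrite linear_sum;
    apply: eq_bigr => c _; rewrite linearZ.
  apply/matrixP => i j; rewrite mxE summxE (bigD1 b) //= [X in _ + X =
    _]big1 => [|c cb]; last first.
    by rewrite mxE (negbTE cb) andbF mul0r.
  rewrite addr0 [RHS](bigD1 j) //= [X in _ = _ + X]big1 => [|c cj]; last first.
    by rewrite !mxE [j == c]eq_sym (negbTE cj) andbF mulr0.
  by rewrite !mxE !eqxx !andbT mulrC addr0.
have TJ : J *m T = T *m J.
  have tbB (X Y : 'M[C]_(n * n)) a b : tens_block (X - Y) a b =
    tens_block X a b - tens_block Y a b.
    by apply/matrixP => i j; rewrite !mxE.
  apply: tens_block_inj => a b; rewrite mulmxBl mulmxBr !tbB.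
  rewrite tens_block_mul1 tens_block_mulr1 tens_block_mull tens_block_mulr.
  under eq_bigr do rewrite mxE mulmx1 Jb.
  under [in RHS]eq_bigr do rewrite mxE mul1mx Jb.
  rewrite HdE dHE Jb; have := Ecov (delta_mx a b); rewrite linearB /= => Ed.
  rewrite -[H *m E _](subrK (E (delta_mx a b) *m H)) -Ed.
  by rewrite [RHS]addrAC [X in _ = X + _]addrAC subrr sub0r addrC.
have [S [Sh SS SC]] := psdmx_sqrt Jp.
have [P [w [PU TE]]] := herm_spectral Th; have PP := unitarymxP PU;
  have P'P := mulmx1C PP.
(* [S] commutes with [T] because [J] does, so it preserves the eigenspaces of [T]. *)
pose V := S *m P^t*.
have VV : V *m V^t* = J.
  by rewrite adjmxM trmxCK Sh mulmxA -[_ *m P^t* *m P]mulmxA P'P mulmx1.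
have TV : T *m V = V *m diag_mx (\row_i (w i)%:C).
  by rewrite mulmxA -(SC _ TJ) {1}TE !mulmxA -mulmxA PP mulmx1.
clearbody V.
pose K k : 'M[C]_n := \matrix_(i, j) V (idx (j, i)) k.
have EK : E =1 kraus K.
  move=> X; rewrite [X in E X]matrix_sum_delta linear_sum; apply/matrixP => i j.
  rewrite summxE [RHS]summxE.
  under [RHS]eq_bigr => k _.
    rewrite mxE; under eq_bigr => b _ do rewrite mxE mulr_suml.
    rewrite exchange_big /=. over.
  rewrite [RHS]exchange_big /=; apply: eq_bigr => a _.
  rewrite linear_sum summxE [RHS]exchange_big /=; apply: eq_bigr => b _.
  rewrite linearZ /= mxE -Jb mxE -VV mxE mulr_sumr; apply: eq_bigr => k _.
  by rewrite !adjmxE !mxE mulrA [X in X * _ = _]mulrC.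
exists K, w; split => //.
- apply/matrixP => i j.
  have trd (A : 'M[C]_n) : \tr (A *m delta_mx j i) = A i j.
    rewrite /mxtrace (bigD1 i) //= [X in _ + X]big1 => [|k ki]; last first.
      by rewrite mxE big1 // => l _; rewrite mxE (negbTE ki) andbF mulr0.
    rewrite addr0 mxE (bigD1 j) //= big1 => [|k kj]; last first.
      by rewrite mxE (negbTE kj) mulr0.
    by rewrite mxE !eqxx mulr1 addr0.
  (* Trace preservation on the matrix unit [delta_mx j i] reads off entry (i, j). *)
  rewrite -trd -[RHS]trd mul1mx -[RHS]Etp EK mulmx_suml !raddf_sum /=.
  by apply: eq_bigr => k _; rewrite [RHS]mxtrace_mulC mulmxA.
move=> k; apply/matrixP => i j.
(* Entry (j, i) of the eigenvector equation is entry (i, j) of H K - K H = w K. *)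
have := congr1 (fun A : 'M[C]_(n * n) => A (idx (j, i)) k) TV.
rewrite mul_mx_diag [RHS]mxE [X in _ = _ * X]mxE mulmxBl mxE [X in _ + X]mxE
  !tens_mul_entry.
rewrite (bigD1 j) //= [X in _ + X - _]big1 => [|c cj]; last first.
  by rewrite big1 // => d _; rewrite mxE eq_sym (negbTE cj) !mul0r.
rewrite addr0 => /eqP; rewrite subr_eq => /eqP HV.
transitivity (\sum_d H i d * V (idx (j, d)) k).
  by rewrite mxE; apply: eq_bigr => d _; rewrite mxE.
transitivity (\sum_d (1%:M : 'M[C]_n) j j * H i d * V (idx (j, d)) k).
  by apply: eq_bigr => d _; rewrite mxE eqxx mul1r.
rewrite HV addrC [RHS]mxE; congr (_ + _); last by rewrite !mxE mulrC.
rewrite mxE; apply: eq_bigr => c _.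
rewrite (bigD1 i) //= big1 => [|d di]; last by rewrite !mxE eq_sym (negbTE di) mulr0
  mul0r.
by rewrite addr0 !mxE eqxx mulr1 mulrC.
Qed.

End kraus.

(** * The Krylov space and the covariant isometry on it *)

Section krylov.
Context {R : realType}.
Local Notation C := R[i].

Lemma exprmx_lin_dep (F : fieldType) n (A : 'M[F]_n) :
  exists c : 'I_n -> F, A ^+ n = \sum_(r < n) c r *: A ^+ r.
Proof.
case: n A => [|n] A; first by exists (fun=> 0); apply/matrixP => -[].
pose p := char_poly A.
exists (fun r => - p`_r).
have := Cayley_Hamilton A.
rewrite /horner_mx /= -/p /horner_morph horner_coef.
rewrite size_map_poly size_char_poly big_ord_recr /= coef_map /=.
have -> : p`_n.+1 = 1.
  by have /monicP := char_poly_monic A; rewrite lead_coefE size_char_poly.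
rewrite mul1r => /eqP; rewrite addrC addr_eq0 => /eqP ->.
rewrite -sumrN; apply: eq_bigr => i _.
by rewrite coef_map /= scaleNr -mulmxE mul_scalar_mx.
Qed.

(* By Cayley-Hamilton the vectors G_r = H^r v with r <= n span an H-invariant space.
   With D = \sum_r G_r G_r^* and pseudo-inverse Q, the map L_k = \sum_r B_kr G_r^* Q
   sends G_r to B_kr = (H - w_k)^r l_k and vanishes on the orthogonal complement. *)
Lemma gram_intertwiner (I : finType) n (H v : 'M[C]_n) (l : I -> 'M[C]_n) (w : I -> R) :
  H^t* = H ->
  (forall r, v^t* *m H ^+ r *m v =
    \sum_k (l k)^t* *m (H - (w k)%:C%:M) ^+ r *m l k) ->
  exists L : I -> 'M[C]_n, exists P : 'M[C]_n,
    [/\ [/\ P^t* = P, P *m P = P, P *m v = v & H *m P = P *m H],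
        \sum_k (L k)^t* *m L k = P, forall k, L k *m v = l k &
        forall k, H *m L k = L k *m H + (w k)%:C *: L k].
Proof.
move=> Hh mom.
pose Hw k := H - (w k)%:C%:M.
have Hwh k : (Hw k)^t* = Hw k.
  rewrite adjmxB Hh tr_scalar_mx map_scalar_mx; congr (_ - _%:M); exact: conjc_real.
(* The index n is included so that [H] sends each member of index below n to the next. As [v] is a
   square matrix, each member holds n vectors. *)
pose G (r : 'I_n.+1) := H ^+ r *m v.
pose B k (r : 'I_n.+1) := Hw k ^+ r *m l k.
(* Equal Gram matrices for all combinations, which makes G_r |-> B_kr well defined and isometric. *)
have gram p (c : 'I_n.+1 -> 'M[C]_(n, p)) :
    \sum_k (\sum_r B k r *m c r)^t* *m (\sum_r B k r *m c r) =
    (\sum_r G r *m c r)^t* *m (\sum_r G r *m c r).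
  rewrite adjmx_sum mulmx_suml.
  under eq_bigr do rewrite adjmx_sum mulmx_suml.
  rewrite exchange_big /=; apply: eq_bigr => r _.
  rewrite mulmx_sumr; under eq_bigr do rewrite mulmx_sumr.
  rewrite exchange_big /=; apply: eq_bigr => s _.
  have -> : (G r *m c r)^t* *m (G s *m c s) =
    (c r)^t* *m (v^t* *m H ^+ (r + s) *m v) *m c s.
    by rewrite /G !adjmxM adjmx_exp Hh exprD -mulmxE !mulmxA.
  rewrite mom mulmx_sumr mulmx_suml; apply: eq_bigr => k _.
  by rewrite /B !adjmxM adjmx_exp Hwh exprD -mulmxE !mulmxA.
pose D := \sum_r G r *m (G r)^t*.
have Dh : D^t* = D by rewrite adjmx_sum; apply: eq_bigr => r _; rewrite adjmxM trmxCK.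
have [Q [Qh DQD QD]] := herm_pinv Dh.
pose P := D *m Q.
have Ph : P^t* = P by rewrite adjmxM Qh Dh.
have PP : P *m P = P by rewrite /P mulmxA DQD.
(* The summed Gram matrix is (1 - P) D (1 - P), and (1 - P) D = 0 because D Q D = D. *)
have G'P r : (G r)^t* *m P = (G r)^t*.
  apply/eqP; rewrite -subr_eq0 -[X in _ - X]mulmx1 -mulmxBr; apply/eqP; move: r.
  apply: sum_adjmx_mul_eq0.
  under eq_bigr do rewrite adjmxM trmxCK mulmxA -[_ *m G _ *m _]mulmxA.
  rewrite -mulmx_suml -mulmx_sumr -/D adjmxB adjmx1 Ph mulmxBl mul1mx.
  by rewrite /P DQD subrr mul0mx.
have PG r : P *m G r = G r.
  by rewrite -[RHS]trmxCK -(G'P r) adjmxM trmxCK Ph.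
pose L k := \sum_r B k r *m ((G r)^t* *m Q).
have LG k s : L k *m G s = B k s.
  apply/eqP; rewrite -subr_eq0; apply/eqP; move: k.
  (* With these coefficients [gram] compares L_k G_s - B_ks with P G_s - G_s, which is 0. *)
  pose c r := (G r)^t* *m Q *m G s - ((r == s)%:R)%:M.
  have cE (Z : 'I_n.+1 -> 'M[C]_n) : \sum_r Z r *m c r =
    (\sum_r Z r *m ((G r)^t* *m Q)) *m G s - Z s.
    under eq_bigr do rewrite mulmxBr.
    rewrite sumrB mulmx_suml; congr (_ - _); first by apply: eq_bigr => r _;
      rewrite !mulmxA.
    rewrite (bigD1 s) //= eqxx mulmx1 big1 ?addr0 // => r rs.
    by rewrite (negbTE rs) mul_mx_scalar scale0r.
  apply: sum_adjmx_mul_eq0; have := gram _ c.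
  under eq_bigr do rewrite cE.
  move=> ->; rewrite cE; under eq_bigr do rewrite mulmxA.
  by rewrite -mulmx_suml -/D -/P PG subrr mulmx0.
have LP k : L k *m P = L k.
  rewrite mulmx_suml; apply: eq_bigr => r _.
  by rewrite -!mulmxA /P [Q *m _]mulmxA QD -/P [_ *m (P *m Q)]mulmxA G'P.
have [c Hn] := exprmx_lin_dep H.
(* Testing r < n suffices: Cayley-Hamilton supplies r = n, and [P] has its range in the span of the
   G_r. *)
have vanish (M : 'M[C]_n) : (forall r : 'I_n, M *m (H ^+ r *m v) = 0) -> M *m P = 0.
  move=> M0; rewrite /P mulmxA mulmx_sumr big1 ?mul0mx // => r _; rewrite mulmxA.
  suff -> : M *m G r = 0 by rewrite mul0mx.
  rewrite /G; have := ltn_ord r; rewrite ltnS leq_eqVlt => /orP[/eqP ->|rn];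
    last exact: (M0 (Ordinal rn)).
  rewrite Hn mulmx_suml mulmx_sumr big1 // => s _.
  by rewrite -scalemxAl -scalemxAr M0 scaler0.
have HG (r : 'I_n) : H *m (H ^+ r *m v) = G (lift ord0 r).
  by rewrite /G lift0 exprS -mulmxE mulmxA.
have HP : H *m P = P *m H.
  have : (P *m H - H) *m P = 0.
    apply: vanish => r; rewrite mulmxBl -mulmxA HG PG subrr //.
  rewrite mulmxBl => /eqP; rewrite subr_eq0 => /eqP PHP.
  (* [P H P] is self-adjoint, so the adjoint of P H P = H P gives P H P = P H. *)
  by have := congr1 (fun A => A^t*) PHP; rewrite (adjmxM (P *m H)) (adjmxM P H)
    (adjmxM H P) Ph Hh mulmxA PHP.
exists L, P; split => //.
- split => //; have := PG ord0; by rewrite /G expr0 mul1mx.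
- rewrite /L gram; under eq_bigr do rewrite mulmxA.
  by rewrite -mulmx_suml -/D -/P Ph PP.
- by move=> k; have := LG k ord0; rewrite /G /B !expr0 !mul1mx.
move=> k; have : (Hw k *m L k - L k *m H) *m P = 0.
  apply: vanish => r; rewrite mulmxBl -!mulmxA HG LG.
  have -> : H ^+ r *m v = G (widen_ord (leqnSn n) r) by [].
  by rewrite LG /B lift0 /= exprS -mulmxE mulmxA subrr.
rewrite mulmxBl -!mulmxA HP LP [L k *m (P *m H)]mulmxA LP => /eqP.
by rewrite subr_eq0 mulmxBl mul_scalar_mx subr_eq => /eqP.
Qed.

End krylov.

(** * Moments of the total Hamiltonian and removal of the catalyst *)

Section moments.
Context {R : realType}.
Local Notation C := R[i].

Lemma tens11 n m : (1%:M : 'M[C]_n) *t (1%:M : 'M[C]_m) = 1%:M.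
Proof.
apply: eq_mxtens_row => i a k; case: (mxtens.mxtens_indexP k) => j b.
rewrite mxtens.tensmxE !mxE (can_eq (@mxtens.mxtens_indexK n m)) xpair_eqE.
by rewrite -mulnb natrM.
Qed.

Lemma tens_exp1r n m (A : 'M[C]_n) k :
  (A *t (1%:M : 'M[C]_m)) ^+ k = A ^+ k *t (1%:M : 'M[C]_m).
Proof.
elim: k => [|k IH]; first by rewrite !expr0 tens11.
by rewrite !exprS IH -!mulmxE mxtens.tensmx_mul mulmx1.
Qed.

Lemma tens_exp1l n m (B : 'M[C]_m) k :
  ((1%:M : 'M[C]_n) *t B) ^+ k = (1%:M : 'M[C]_n) *t (B ^+ k).
Proof.
elim: k => [|k IH]; first by rewrite !expr0 tens11.
by rewrite !exprS IH -!mulmxE mxtens.tensmx_mul mulmx1.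
Qed.

(** The two summands commute, so the binomial theorem applies; [j] counts the factors acting on the
    auxiliary system. *)
Lemma total_hamiltonian_exp_emb n m (A : 'M[C]_n) (B : 'M[C]_m) psi r :
  total_hamiltonian A B ^+ r *m emb n psi =
  \sum_(j < r.+1) (emb n (B ^+ j *m psi) *m A ^+ (r - j)) *+ 'C(r, j).
Proof.
rewrite exprDn_comm; last by rewrite /GRing.comm -!mulmxE !mxtens.tensmx_mul !mulmx1
  !mul1mx.
rewrite mulmx_suml; apply: eq_bigr => j _.
rewrite tens_exp1r tens_exp1l -mulmxE mxtens.tensmx_mul mulmx1 mul1mx.
by rewrite -scaler_nat -scalemxAl scaler_nat tens_emb.
Qed.

(** By strong induction: the term j = 0 is the r-th one itself since [c 0 = 1], and the others have
    smaller index. *)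
Lemma binomial_conv_inj n (c : nat -> C) (X Y : nat -> 'M[C]_n) :
  c 0 = 1 ->
  (forall r, \sum_(j < r.+1) c j *: X (r - j)%N *+ 'C(r, j) =
             \sum_(j < r.+1) c j *: Y (r - j)%N *+ 'C(r, j)) ->
  X =1 Y.
Proof.
move=> c0 XY r; elim/ltn_ind: r => r IH; have := XY r.
rewrite !big_ord_recl /= !subn0 !bin0 c0 !scale1r !mulr1n.
rewrite [X in _ + X = _](eq_bigr (fun j : 'I_r => c (bump 0 j) *: Y (r - bump 0 j)%N
  *+ 'C(r, bump 0 j))).
  exact: addIr.
by move=> j _; rewrite IH // /bump /= add1n ltn_subrL /= (leq_ltn_trans _ (ltn_ord j)).
Qed.

Lemma no_pure_catalysis (n m : nat) (HS rho rho' : 'M[C]_n) (HC : 'M[C]_m)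
    (phi : 'cV[C]_m) (E : {linear 'M[C]_(n * m) -> 'M[C]_(n * m)}) :
  HS \is hermsymmx -> density rho -> HC \is hermsymmx -> unit_vector phi ->
  TIO (total_hamiltonian HS HC) E ->
  E (rho *t ketbra phi) = rho' *t ketbra phi ->
  exists F : {linear 'M[C]_n -> 'M[C]_n}, TIO HS F /\ F rho = rho'.
Proof.
move=> HSh [rhop _] HCh phi1 ETIO Erho.
have Hh : total_hamiltonian HS HC \is hermsymmx.
  apply/hermsymmxP; rewrite adjmxD !adjmx_tens !adjmx1.
  by rewrite (hermsymmxP HSh) (hermsymmxP HCh).
have [K [w [EK K1 HK]]] := TIO_kraus Hh ETIO.
(* A matrix square root stands in for a state vector, so that mixed rho is covered. *)
have [v [vh vv _]] := psdmx_sqrt rhop.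
pose J := emb n phi.
have J1 : J^t* *m J = 1%:M by rewrite adj_emb_emb phi1.
pose Z k := K k *m (J *m v).
have ZZ : \sum_k Z k *m (Z k)^t* = J *m rho' *m J^t*.
  rewrite emb_mul_adj -Erho EK /kraus -emb_mul_adj -vv; apply: eq_bigr => k _.
  by rewrite /Z (adjmxM (K k)) adjmxM vh !mulmxA.
pose l k := J^t* *m Z k.
(* [N] projects onto the complement of the range of [J]. It annihilates the positive sum in [ZZ],
   hence every [Z k]. *)
have ZJl k : Z k = J *m l k.
  pose N : 'M[C]_(n * m) := 1%:M - J *m J^t*.
  have Nh : N^t* = N by rewrite adjmxB adjmx1 adjmxM trmxCK.
  have NJ : N *m J = 0 by rewrite mulmxBl mul1mx -mulmxA J1 mulmx1 subrr.
  have ZN : (Z k)^t* *m N = 0.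
    move: k; apply: sum_adjmx_mul_eq0.
    under eq_bigr do rewrite adjmxM trmxCK Nh mulmxA -[_ *m Z _ *m _]mulmxA.
    by rewrite -mulmx_suml -mulmx_sumr ZZ !mulmxA NJ !mul0mx.
  have : N *m Z k = 0 by rewrite -[LHS]trmxCK adjmxM Nh ZN adjmx0.
  by rewrite mulmxBl mul1mx -mulmxA => /eqP; rewrite subr_eq0 => /eqP.
have rho'E : \sum_k l k *m (l k)^t* = rho'.
  under eq_bigr do rewrite adjmxM trmxCK mulmxA -[_ *m Z _ *m _]mulmxA.
  by rewrite -mulmx_suml -mulmx_sumr ZZ !mulmxA J1 mul1mx -mulmxA J1 mulmx1.
pose c j := (phi^t* *m HC ^+ j *m phi) 0 0.
have momJ (A x : 'M[C]_n) r : (J *m x)^t* *m total_hamiltonian A HC ^+ r *m (J *m x) =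
    \sum_(j < r.+1) c j *: (x^t* *m A ^+ (r - j) *m x) *+ 'C(r, j).
  rewrite adjmxM -!mulmxA [_ ^+ r *m _]mulmxA total_hamiltonian_exp_emb.
  rewrite mulmx_suml !mulmx_sumr; apply: eq_bigr => j _.
  rewrite -[in LHS]scaler_nat -scalemxAl -!scalemxAr scaler_nat; congr (_ *+ _).
  by rewrite -!mulmxA [J^t* *m _]mulmxA adj_emb_emb mul_scalar_mx -scalemxAr !mulmxA.
have HwK k r : (total_hamiltonian HS HC - (w k)%:C%:M) ^+ r *m K k =
  K k *m total_hamiltonian HS HC ^+ r.
  elim: r => [|r IH]; first by rewrite !expr0 mul1mx mulmx1.
  rewrite !exprS -!mulmxE -mulmxA IH !mulmxA; congr (_ *m _).
  by rewrite mulmxBl HK mul_scalar_mx addrK.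
(* The frequency shift is absorbed into the Hamiltonian of S, so [momJ] covers the shifted moments
   too. *)
have Hw k : total_hamiltonian (HS - (w k)%:C%:M) HC =
  total_hamiltonian HS HC - (w k)%:C%:M.
  rewrite /total_hamiltonian addrAC; congr (_ + _).
  rewrite -(scalemx1 n (w k)%:C) -(scalemx1 (n * m) (w k)%:C) -tens11.
  by apply/matrixP => i j; rewrite !mxE mulrBl mulrA.
have mom r : v^t* *m HS ^+ r *m v =
    \sum_k (l k)^t* *m (HS - (w k)%:C%:M) ^+ r *m l k.
  move: r; apply: (@binomial_conv_inj _ c) => [|r];
    first by rewrite /c expr0 mulmx1 phi1.
  rewrite -momJ.
  transitivity (\sum_k (J *m l k)^t* *m total_hamiltonian (HS - (w k)%:C%:M) HC ^+ r
    *m (J *m l k)).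
    (* Trace preservation inserts the sum of the K_k^* K_k; each [K k] then passes through the
       powers by [HwK]. *)
    transitivity (\sum_k (J *m v)^t* *m ((K k)^t* *m K k) *m (total_hamiltonian HS HC
      ^+ r *m (J *m v))).
      by rewrite -mulmx_suml -mulmx_sumr K1 mulmx1 [RHS]mulmxA.
    apply: eq_bigr => k _; rewrite -ZJl Hw /Z (adjmxM (K k)) -!mulmxA;
      do 2 congr (_ *m _).
    by rewrite !mulmxA HwK.
  under eq_bigr do rewrite momJ.
  rewrite exchange_big /=; apply: eq_bigr => j _.
  by rewrite sumrMnl scaler_sumr.
have [L [P [[Ph PP Pv HP] LL Lv HL]]] := gram_intertwiner (hermsymmxP HSh) mom.
(* The extra operator 1 - P completes the sum to 1, has frequency 0 as it commutes with [HS], and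
   kills [v], so it leaves the output unchanged. *)
pose M (s : 'I_(n * m * (n * m)) + unit) := if s is inl k then L k else 1%:M - P.
pose wM (s : 'I_(n * m * (n * m)) + unit) := if s is inl k then w k else 0.
exists (kraus M); split.
  apply: (kraus_TIO (w := wM)) => // [|[k|[]] /=].
  - rewrite big_sumType /= LL (big_pred1 tt) => [|[]//].
    rewrite adjmxB adjmx1 Ph mulmxBl mul1mx mulmxBr mulmx1 PP subrr subr0.
    by rewrite addrC subrK.
  - exact: HL.
  - by rewrite mulmxBl mulmxBr mul1mx mulmx1 HP rmorph0 scale0r addr0.
rewrite /= /kraus big_sumType /= (big_pred1 tt) => [|[]//].
rewrite -vv [X in _ + X](_ : _ = 0) ?addr0; last first.
  by rewrite mulmxA mulmxBl mul1mx Pv subrr !mul0mx.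
rewrite -rho'E; apply: eq_bigr => k _.
by rewrite -Lv adjmxM vh !mulmxA.
Qed.
End moments.

Theorem theorem1 (R : realType) (n : nat) (HS rho rho' : 'M[R[i]]_n) :
  HS \is hermsymmx -> density rho -> density rho' ->
  ~ (exists E : {linear 'M[R[i]]_n -> 'M[R[i]]_n}, TIO HS E /\ E rho = rho') ->
  forall (m : nat) (HC : 'M[R[i]]_m) (phi : 'cV[R[i]]_m),
    HC \is hermsymmx -> unit_vector phi ->
    ~ (exists E : {linear 'M[R[i]]_(n * m) -> 'M[R[i]]_(n * m)},
         TIO (total_hamiltonian HS HC) E
         /\ E (rho *t ketbra phi) = rho' *t ketbra phi).
Proof.
move=> HSh rhod _ noF m HC phi HCh phi1 [E [ETIO Erho]].
exact/noF/(no_pure_catalysis HSh rhod HCh phi1 ETIO Erho).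
Qed.
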